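(* Let $r_0\in\,]0,1[$, let $A=\{z\in\mathbb{C}: r_0<|z|<1\}$, and let $\mu$ be a complex (Borel) measure on $\partial A=\mathbb{T}\cup r_0\mathbb{T}$, where $\mathbb{T}=\{|z|=1\}$. For $j\in\mathbb{Z}$ define $$\widehat{\mu}^0_j=\int_{r_0\mathbb{T}} z^{-j}\,d\mu(z),\qquad \widehat{\mu}^1_j=\int_{\mathbb{T}} z^{-j}\,d\mu(z).$$ If $\widehat{\mu}^0_j=-\widehat{\mu}^1_j$ for all $j\in\mathbb{Z}$, then every subset of $\partial A$ of arclength measure $0$ is a null set with respect to $\mu$.
   Context: A subset of $\partial A$ has arclength measure $0$ if its intersections with $\mathbb{T}$ and with $r_0\mathbb{T}$ both have arclength (one-dimensional Lebesgue) measure $0$; being a null set with respect to a complex measure $\mu$ means being a null set for its total variation $|\mu|$. *)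

(* Defs.v *)
From mathcomp Require Import all_boot all_algebra.
From mathcomp Require Import all_classical all_reals all_analysis.
From mathcomp Require Import complex.
Set Implicit Arguments. Unset Strict Implicit. Unset Printing Implicit Defensive.
Import GRing.Theory Num.Theory ComplexField.
Local Open Scope classical_set_scope.
Local Open Scope ring_scope.

Section annulus.
Variable R : realType.

(* The plane C is modelled as R * R with its (Borel = product) sigma-algebra. *)
Definition toC (p : R * R) : R[i] := (p.1 +i* p.2)%C.

Definition circle (r : R) : set (R * R) := [set p | p.1 ^+ 2 + p.2 ^+ 2 = r ^+ 2].

Definition bdA (r0 : R) : set (R * R) := circle 1 `|` circle r0.

(* A complex measure mu is given as mu = (n1 - n2) + i (n3 - n4) with finite
   (positive) measures n1..n4 (Jordan decompositions of Re mu and Im mu). *)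
Record cmeasure := CMeasure {
  cm1 : {finite_measure set (R * R)%type -> \bar R};
  cm2 : {finite_measure set (R * R)%type -> \bar R};
  cm3 : {finite_measure set (R * R)%type -> \bar R};
  cm4 : {finite_measure set (R * R)%type -> \bar R} }.

Definition cmval (mu : cmeasure) (E : set (R * R)) : R[i] :=
  ((fine (cm1 mu E) - fine (cm2 mu E)) +i* (fine (cm3 mu E) - fine (cm4 mu E)))%C.

Definition cm_on (mu : cmeasure) (S : set (R * R)) :=
  [/\ cm1 mu (~` S) = 0%E, cm2 mu (~` S) = 0%E,
      cm3 mu (~` S) = 0%E & cm4 mu (~` S) = 0%E].

Definition cmint (mu : cmeasure) (D : set (R * R)) (f : R * R -> R[i]) : R[i] :=
  let u := fun p => complex.Re (f p) in
  let v := fun p => complex.Im (f p) in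
  ((Rintegral (cm1 mu) D u - Rintegral (cm2 mu) D u
    - Rintegral (cm3 mu) D v + Rintegral (cm4 mu) D v)
   +i* (Rintegral (cm1 mu) D v - Rintegral (cm2 mu) D v
    + Rintegral (cm3 mu) D u - Rintegral (cm4 mu) D u))%C.

Definition mu_hat (mu : cmeasure) (r : R) (j : int) : R[i] :=
  cmint mu (circle r) (fun p => toC p ^ (- j)).

Definition cm_totvar (mu : cmeasure) (E : set (R * R)) : \bar R :=
  ereal_sup [set (\sum_(0 <= n <oo) ((Normc.normc (cmval mu (F n)))%:E))%E
            | F in [set F : (set (R * R))^nat |
                    [/\ forall n, measurable (F n), trivIset setT F &
                        \bigcup_n F n = E]]].

Definition cm_null (mu : cmeasure) (E : set (R * R)) :=
  exists F, [/\ measurable F, E `<=` F & cm_totvar mu F = 0%E].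

Definition arclength_null (r : R) (S : set (R * R)) :=
  (@lebesgue_measure R).-negligible
    [set t : R | t \in `[0, 2 * pi]%R /\ S (r * cos t, r * sin t)].

End annulus.

(* Main.v *)
(** Øksendal's argument for the theorem of F. and M. Riesz, run directly on the
    annulus. The hypothesis says that [mu] annihilates all Laurent polynomials,
    so with [zeta = z] (outer circle) or [zeta = r0 / z] (inner circle), which
    maps [bdA r0] into the closed unit disc, all moments of [zeta] vanish. Hence
    so do the integrals of products of factors
    [(zeta - g) / (zeta - (1 + rho) g)], [|g| = 1]. Such a factor is bounded by
    [1], its modulus is at most [1 / sqrt 2] within distance [rho] of [g], and
    it differs from [1] by at most [rho / |zeta - g|]. A compact set [K] of zero
    arclength is covered by finitely many discs with radii of sum at most
    [1 / m^2]; the [m]-th powers of the corresponding products converge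
    boundedly to the indicator of the complement of [K], so [mu K = 0].
    Inner regularity of finite measures extends this to Borel sets. *)

Require Import Defs.
From mathcomp Require Import all_boot all_order all_algebra.
From mathcomp Require Import all_classical all_reals all_analysis.
From mathcomp Require Import measurable_realfun complex ring lra.
Set Implicit Arguments. Unset Strict Implicit. Unset Printing Implicit Defensive.
Import Order.TTheory GRing.Theory Num.Theory ComplexField ComplexField.Normc.
Import numFieldNormedType.Exports.
Local Open Scope classical_set_scope.
Local Open Scope ring_scope.

(** * Moduli of complex numbers and estimates for a single peak factor *)

Section peak_factor.
Variable R : realType.
Implicit Types (x y z g w : R[i]) (rho : R).

Lemma normc_sqrE z : normc z ^+ 2 = complex.Re z ^+ 2 + complex.Im z ^+ 2.
Proof. by case: z => a b; rewrite /normc sqr_sqrtr// addr_ge0// sqr_ge0. Qed.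

Lemma normc_ge0 z : 0 <= normc z.
Proof. by case: z => a b; rewrite sqrtr_ge0. Qed.

Lemma normc_Re z : `|complex.Re z| <= normc z.
Proof.
rewrite -(@ler_pXn2r _ 2)// ?nnegrE ?normc_ge0// normc_sqrE real_normK ?num_real//.
by rewrite lerDl sqr_ge0.
Qed.

Lemma normc_Im z : `|complex.Im z| <= normc z.
Proof.
rewrite -(@ler_pXn2r _ 2)// ?nnegrE ?normc_ge0// normc_sqrE real_normK ?num_real//.
by rewrite lerDr sqr_ge0.
Qed.

Lemma normc_le_sum z : normc z <= `|complex.Re z| + `|complex.Im z|.
Proof.
rewrite -(@ler_pXn2r _ 2)// ?nnegrE ?normc_ge0 ?addr_ge0// normc_sqrE.
rewrite -(real_normK (num_real (complex.Re z))) -(real_normK (num_real (complex.Im z))).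
have := normr_ge0 (complex.Re z); have := normr_ge0 (complex.Im z); nra.
Qed.

Lemma normcX z n : normc (z ^+ n) = normc z ^+ n.
Proof.
elim: n => [|n IH]; first by rewrite !expr0 normc1.
by rewrite !exprS normcM IH.
Qed.

Lemma normcR (r : R) : normc r%:C%C = `|r|.
Proof. by rewrite /normc/= expr0n addr0 sqrtr_sqr. Qed.

Lemma normcBC x y : normc (x - y) = normc (y - x).
Proof. by rewrite -normcN opprB. Qed.

Lemma normc_eq0 z : (normc z == 0) = (z == 0).
Proof.
by apply/eqP/eqP => [/eq0_normc//|->]; exact: normc0.
Qed.

Lemma normc_gt0 z : (0 < normc z) = (z != 0).
Proof. by rewrite lt0r normc_eq0 normc_ge0 andbT. Qed.

Definition pole g rho : R[i] := (1 + rho)%:C%C * g.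

Definition peak g rho z : R[i] := (z - g) / (z - pole g rho).

(** The difference of the two sides is [2 * rho * (1 - Re (z * conj g))], which is nonnegative
    because [z] lies in the closed unit disc and [g] on the unit circle. Every bound on [peak] below
    comes from this inequality. *)
Lemma sqr_normc_sub_pole g rho z : normc g = 1 -> 0 <= rho -> normc z <= 1 ->
  normc (z - g) ^+ 2 + rho ^+ 2 <= normc (z - pole g rho) ^+ 2.
Proof.
move=> g1 rho0 z1.
have g2 : normc g ^+ 2 = 1 by rewrite g1 expr1n.
have z2 : normc z ^+ 2 <= 1 by rewrite expr_le1// normc_ge0.
move: g2 z2; rewrite !normc_sqrE {g1 z1}.
case: g z => [c d] [a b]/= g2 z2.
have : 0 <= rho * (c ^+ 2 + d ^+ 2 - a * c - b * d).
  apply: mulr_ge0 => //.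
  have := sqr_ge0 (a - c); have := sqr_ge0 (b - d); nra.
nra.
Qed.

Lemma normc_pole g rho : normc g = 1 -> 0 <= rho -> normc (pole g rho) = 1 + rho.
Proof.
by move=> g1 rho0; rewrite /pole normcM g1 mulr1 normcR ger0_norm// addr_ge0.
Qed.

Lemma normc_sub_pole_gt0 g rho z : normc g = 1 -> 0 < rho -> normc z <= 1 ->
  0 < normc (z - pole g rho).
Proof.
move=> g1 rho0 z1; have := sqr_normc_sub_pole g1 (ltW rho0) z1.
have := normc_ge0 (z - pole g rho); rewrite le_eqVlt => /predU1P[<-|//].
have := sqr_ge0 (normc (z - g)); nra.
Qed.

Lemma normc_sub_pole_ge g rho z : normc g = 1 -> 0 < rho -> normc z <= 1 ->
  normc (z - g) <= normc (z - pole g rho).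
Proof.
move=> g1 rho0 z1; have := sqr_normc_sub_pole g1 (ltW rho0) z1.
move=> h; rewrite -(@ler_pXn2r _ 2)// ?nnegrE ?normc_ge0//.
by apply: le_trans h; rewrite lerDl sqr_ge0.
Qed.

Lemma normc_peak_le1 g rho z : normc g = 1 -> 0 < rho -> normc z <= 1 ->
  normc (peak g rho z) <= 1.
Proof.
move=> g1 rho0 z1; rewrite /peak normcM normcV.
by rewrite ler_pdivrMr ?mul1r ?normc_sub_pole_ge ?normc_sub_pole_gt0.
Qed.

Lemma sqr_normc_peak_le_half g rho z : normc g = 1 -> 0 < rho -> normc z <= 1 ->
  normc (z - g) <= rho -> normc (peak g rho z) ^+ 2 <= 2^-1.
Proof.
move=> g1 rho0 z1 zg; rewrite /peak normcM normcV expr_div_n.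
have p0 := normc_sub_pole_gt0 g1 rho0 z1.
rewrite ler_pdivrMr ?exprn_gt0//.
have := sqr_normc_sub_pole g1 (ltW rho0) z1.
have := normc_ge0 (z - g); nra.
Qed.

Lemma normc_1sub_peak g rho z : normc g = 1 -> 0 < rho -> normc z <= 1 ->
  normc (1 - peak g rho z) = rho / normc (z - pole g rho).
Proof.
move=> g1 rho0 z1; have := normc_sub_pole_gt0 g1 rho0 z1.
rewrite normc_gt0 => p0.
have -> : 1 - peak g rho z = (- rho%:C%C * g) / (z - pole g rho).
  rewrite /peak -{1}(divff p0) -mulrBl; congr (_ / _).
  rewrite /pole rmorphD/= rmorph1 mulrDl mul1r mulNr.
  by ring.
by rewrite normcM normcV normcM normcN normcR g1 mulr1 ger0_norm ?ltW.
Qed.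

(** Induction through [1 - a b = (1 - a) + a (1 - b)], where [|a| <= 1] keeps the second term from
    growing. *)
Lemma normc_1sub_prod (I : eqType) (s : seq I) (f : I -> R[i]) :
  {in s, forall i, normc (f i) <= 1} ->
  normc (1 - \prod_(i <- s) f i) <= \sum_(i <- s) normc (1 - f i).
Proof.
elim: s => [|i s IH] f1; first by rewrite !big_nil subrr normc0.
rewrite !big_cons.
have -> : 1 - f i * \prod_(j <- s) f j
    = (1 - f i) + f i * (1 - \prod_(j <- s) f j).
  by rewrite mulrBr mulr1 addrA subrK.
rewrite (le_trans (le_normcD _ _))// lerD2l normcM.
rewrite (@le_trans _ _ (normc (1 - \prod_(j <- s) f j)))//.
  by rewrite ler_piMl ?normc_ge0// f1 ?mem_head.
by apply: IH => j js; rewrite f1// inE js orbT.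
Qed.

Lemma normc_prod_le1 (I : eqType) (s : seq I) (f : I -> R[i]) :
  {in s, forall i, normc (f i) <= 1} -> normc (\prod_(i <- s) f i) <= 1.
Proof.
move=> f1; rewrite big_seq; elim/big_ind : _ => //; first by rewrite normc1.
by move=> x y x1 y1; rewrite normcM mulr_ile1 ?normc_ge0.
Qed.

Lemma normc_1subX z n : normc z <= 1 -> normc (1 - z ^+ n) <= n%:R * normc (1 - z).
Proof.
move=> z1; elim: n => [|n IH]; first by rewrite expr0 subrr normc0 mul0r.
have -> : 1 - z ^+ n.+1 = (1 - z) + z * (1 - z ^+ n).
  by rewrite mulrBr mulr1 addrA subrK exprS.
rewrite (le_trans (le_normcD _ _))// -natr1 mulrDl mul1r addrC lerD2r normcM.
by rewrite (le_trans _ IH)// ler_piMl// normc_ge0.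
Qed.

End peak_factor.

(** * Integrals of bounded real functions for a finite measure *)

Section bounded_real_functions.
Context d (T : measurableType d) (R : realType).
Variables (nu : {finite_measure set T -> \bar R}) (S : set T).
Hypothesis mS : measurable S.
Implicit Types (u v : T -> R) (B : R).

Lemma bounded_integrable u B : measurable_fun S u ->
  (forall p, S p -> `|u p| <= B) -> nu.-integrable S (EFin \o u).
Proof.
move=> mu uB; apply: measurable_bounded_integrable => //.
  by rewrite ltey_eq fin_num_measure.
exists B; split; first exact: num_real.
by move=> M BM p Sp /=; rewrite (le_trans (uB _ Sp))// ltW.
Qed.

Lemma Rintegral_bounded_le u B : measurable_fun S u ->
  (forall p, S p -> `|u p| <= B) -> `|\int[nu]_(p in S) u p| <= B * fine (nu S).
Proof.
move=> mu uB; have iu := bounded_integrable mu uB.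
rewrite (le_trans (le_normr_Rintegral mS iu))// -(Rintegral_cst nu mS).
apply: le_Rintegral => //.
  by apply: integrable_norm.
apply: (@bounded_integrable (cst B) `|B|) => //.
Qed.

(** Dominated convergence: the constant [B] is an integrable majorant because [nu] is finite. *)
Lemma Rintegral_cvg_bounded (u_ : nat -> T -> R) u B :
  (forall n, measurable_fun S (u_ n)) -> measurable_fun S u ->
  (forall n p, S p -> `|u_ n p| <= B) ->
  (forall p, S p -> u_ n p @[n --> \oo] --> u p) ->
  \int[nu]_(p in S) u_ n p @[n --> \oo] --> \int[nu]_(p in S) u p.
Proof.
move=> mu_ mu uB u_u.
have [] := @dominated_convergence _ T R nu S mS (fun n => EFin \o u_ n)
  (EFin \o u) (EFin \o cst B).
- by move=> n; apply/measurable_EFinP.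
- exact/measurable_EFinP.
- apply: aeW => p Sp; apply: cvg_EFin; first exact: nearW.
  exact: u_u.
- exact: (@bounded_integrable (cst B) `|B|).
- by apply: aeW => p n Sp; rewrite /= lee_fin uB.
move=> iu _ cv.
by apply: fine_cvg; rewrite fineK//; exact: integrable_fin_num.
Qed.

End bounded_real_functions.

(** Inversion is continuous off [0]; on the singleton [[set 0]] it is constant, by the convention
    [0^-1 = 0]. *)
Lemma measurable_invr (R : realType) : measurable_fun setT (@GRing.inv R).
Proof.
have -> : [set: R] = [set 0] `|` ~` [set 0] by rewrite setUv.
apply/measurable_funU => //; first exact: measurableC.
split.
  apply: (@eq_measurable_fun _ _ R R _ (cst 0)) => [x|]; last exact: measurable_cst.
  by rewrite inE => ->; rewrite invr0.
apply: open_continuous_measurable_fun.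
  by rewrite openC; exact: closed_eq.
by move=> x; rewrite inE/= => /eqP x0; exact: inv_continuous.
Qed.

(** * The integral of bounded complex functions against a complex measure *)

Section complex_integral.
Variables (R : realType) (mu : cmeasure R) (S : set (R * R)).
Hypothesis mS : measurable S.
Implicit Types (f g : R * R -> R[i]) (B : R).

Definition cmeasurable f :=
  measurable_fun S (fun p => complex.Re (f p)) /\
  measurable_fun S (fun p => complex.Im (f p)).

Definition bounded_by B f := forall p, S p -> normc (f p) <= B.

(** A class on which [cmint] is linear: its members have real and imaginary parts integrable for all
    four finite measures. It is also stable under products. *)
Definition bmeasurable f := cmeasurable f /\ exists B, bounded_by B f.

Lemma ReD (x y : R[i]) : complex.Re (x + y) = complex.Re x + complex.Re y.
Proof. by case: x; case: y. Qed.

Lemma ImD (x y : R[i]) : complex.Im (x + y) = complex.Im x + complex.Im y.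
Proof. by case: x; case: y. Qed.

Lemma ReM (x y : R[i]) : complex.Re (x * y) =
  complex.Re x * complex.Re y - complex.Im x * complex.Im y.
Proof. by case: x; case: y. Qed.

Lemma ImM (x y : R[i]) : complex.Im (x * y) =
  complex.Re x * complex.Im y + complex.Im x * complex.Re y.
Proof. by case: x; case: y. Qed.

Lemma ReV (x : R[i]) : complex.Re x^-1 =
  complex.Re x * (complex.Re x ^+ 2 + complex.Im x ^+ 2)^-1.
Proof. by case: x. Qed.

Lemma ImV (x : R[i]) : complex.Im x^-1 =
  - (complex.Im x * (complex.Re x ^+ 2 + complex.Im x ^+ 2)^-1).
Proof. by case: x => a b /=; rewrite ?mulNr. Qed.

Lemma cmeasurable_cst (a : R[i]) : cmeasurable (fun=> a).
Proof. by split; exact: measurable_cst. Qed.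

Lemma cmeasurableD f g : cmeasurable f -> cmeasurable g ->
  cmeasurable (fun p => f p + g p).
Proof.
move=> [fr fi] [gr gi]; split.
- by under eq_fun do rewrite ReD; exact: measurable_funD.
- by under eq_fun do rewrite ImD; exact: measurable_funD.
Qed.

Lemma cmeasurableM f g : cmeasurable f -> cmeasurable g ->
  cmeasurable (fun p => f p * g p).
Proof.
move=> [fr fi] [gr gi]; split.
- under eq_fun do rewrite ReM.
  by apply: measurable_funB; exact: measurable_funM.
- under eq_fun do rewrite ImM.
  by apply: measurable_funD; exact: measurable_funM.
Qed.

Lemma cmeasurableV f : cmeasurable f -> cmeasurable (fun p => (f p)^-1).
Proof.
move=> [fr fi].
have m2 : measurable_fun S
    (fun p => (complex.Re (f p) ^+ 2 + complex.Im (f p) ^+ 2)^-1).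
  apply: (measurableT_comp (@measurable_invr R)).
  by apply: measurable_funD; exact: measurable_funX.
split.
- under eq_fun do rewrite ReV.
  exact: measurable_funM.
- under eq_fun do rewrite ImV.
  by apply: measurable_funN; exact: measurable_funM.
Qed.

Lemma bmeasurable_cst (a : R[i]) : bmeasurable (fun=> a).
Proof. by split; [exact: cmeasurable_cst|exists (normc a)]. Qed.

Lemma bmeasurableD f g : bmeasurable f -> bmeasurable g ->
  bmeasurable (fun p => f p + g p).
Proof.
move=> [mf [A fA]] [mg [B gB]]; split; first exact: cmeasurableD.
exists (A + B) => p Sp; rewrite (le_trans (le_normcD _ _))// lerD//.
  exact: fA.
exact: gB.
Qed.

Lemma bmeasurableM f g : bmeasurable f -> bmeasurable g ->
  bmeasurable (fun p => f p * g p).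
Proof.
move=> [mf [A fA]] [mg [B gB]]; split; first exact: cmeasurableM.
exists (A * B) => p Sp; rewrite normcM ler_pM// ?normc_ge0//.
  exact: fA.
exact: gB.
Qed.

Lemma bmeasurableX f n : bmeasurable f -> bmeasurable (fun p => f p ^+ n).
Proof.
move=> bf; elim: n => [|n IH].
  by under eq_fun do rewrite expr0; exact: bmeasurable_cst.
by under eq_fun do rewrite exprS; exact: bmeasurableM.
Qed.

Let iRe (nu : {finite_measure set (R * R)%type -> \bar R}) f : bmeasurable f ->
  nu.-integrable S (EFin \o (fun p => complex.Re (f p))).
Proof.
move=> [[mf _] [B fB]]; apply: bounded_integrable => // p Sp.
exact: le_trans (normc_Re _) (fB _ Sp).
Qed.

Let iIm (nu : {finite_measure set (R * R)%type -> \bar R}) f : bmeasurable f ->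
  nu.-integrable S (EFin \o (fun p => complex.Im (f p))).
Proof.
move=> [[_ mf] [B fB]]; apply: bounded_integrable => // p Sp.
exact: le_trans (normc_Im _) (fB _ Sp).
Qed.

Lemma eq_cmint D f g : (forall p, D p -> f p = g p) -> cmint mu D f = cmint mu D g.
Proof.
move=> fg.
have er (nu : {measure set (R * R)%type -> \bar R}) :
    \int[nu]_(p in D) complex.Re (f p) = \int[nu]_(p in D) complex.Re (g p).
  by apply: eq_Rintegral => p; rewrite inE => /fg ->.
have ei (nu : {measure set (R * R)%type -> \bar R}) :
    \int[nu]_(p in D) complex.Im (f p) = \int[nu]_(p in D) complex.Im (g p).
  by apply: eq_Rintegral => p; rewrite inE => /fg ->.
by rewrite /cmint !er !ei.
Qed.

Lemma cmintD f g : bmeasurable f -> bmeasurable g ->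
  cmint mu S (fun p => f p + g p) = cmint mu S f + cmint mu S g.
Proof.
move=> bf bg.
have er (nu : {finite_measure set (R * R)%type -> \bar R}) :
    \int[nu]_(p in S) complex.Re (f p + g p) =
    \int[nu]_(p in S) complex.Re (f p) + \int[nu]_(p in S) complex.Re (g p).
  by rewrite -RintegralD//; [under eq_Rintegral do rewrite ReD|exact: iRe|exact: iRe].
have ei (nu : {finite_measure set (R * R)%type -> \bar R}) :
    \int[nu]_(p in S) complex.Im (f p + g p) =
    \int[nu]_(p in S) complex.Im (f p) + \int[nu]_(p in S) complex.Im (g p).
  by rewrite -RintegralD//; [under eq_Rintegral do rewrite ImD|exact: iIm|exact: iIm].
rewrite /cmint !er !ei; apply/eqP; rewrite eq_complex/=.
by apply/andP; split; apply/eqP; ring.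
Qed.

Lemma cmintZ (a : R[i]) f : bmeasurable f ->
  cmint mu S (fun p => a * f p) = a * cmint mu S f.
Proof.
move=> bf.
have iZ (nu : {finite_measure set (R * R)%type -> \bar R}) (r : R) u :
    nu.-integrable S (EFin \o u) -> nu.-integrable S (EFin \o (fun p => r * u p)).
  by move=> iu; apply: (eq_integrable mS _ _ _ (integrableZl mS r iu)) => p _ /=; rewrite EFinM.
have er (nu : {finite_measure set (R * R)%type -> \bar R}) :
    \int[nu]_(p in S) complex.Re (a * f p) =
    complex.Re a * \int[nu]_(p in S) complex.Re (f p)
    - complex.Im a * \int[nu]_(p in S) complex.Im (f p).
  under eq_Rintegral do rewrite ReM.
  rewrite RintegralB//; [|by apply: iZ; exact: iRe|by apply: iZ; exact: iIm].
  by rewrite !RintegralZl//; [exact: iIm|exact: iRe].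
have ei (nu : {finite_measure set (R * R)%type -> \bar R}) :
    \int[nu]_(p in S) complex.Im (a * f p) =
    complex.Re a * \int[nu]_(p in S) complex.Im (f p)
    + complex.Im a * \int[nu]_(p in S) complex.Re (f p).
  under eq_Rintegral do rewrite ImM.
  rewrite RintegralD//; [|by apply: iZ; exact: iIm|by apply: iZ; exact: iRe].
  by rewrite !RintegralZl//; [exact: iRe|exact: iIm].
rewrite /cmint !er !ei; case: a {er ei} => a b.
apply/eqP; rewrite eq_complex/=.
by apply/andP; split; apply/eqP; ring.
Qed.

(** One constant [M] serves all [f] and [B], so a whole family of moments can be bounded at once.
    The factor [2] arises because the real and the imaginary part of the integral are each bounded
    by [B] times the sum of the four masses. *)
Lemma normc_cmint_le : exists M, forall f B, cmeasurable f -> bounded_by B f ->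
  normc (cmint mu S f) <= M * B.
Proof.
exists (2 * (fine (cm1 mu S) + fine (cm2 mu S) + fine (cm3 mu S) + fine (cm4 mu S))).
move=> f B [mfr mfi] fB; rewrite (le_trans (normc_le_sum _))//= /cmint/=.
have br (nu : {finite_measure set (R * R)%type -> \bar R}) :
    `|\int[nu]_(p in S) complex.Re (f p)| <= B * fine (nu S).
  apply: Rintegral_bounded_le => // p Sp.
  exact: le_trans (normc_Re _) (fB _ Sp).
have bi (nu : {finite_measure set (R * R)%type -> \bar R}) :
    `|\int[nu]_(p in S) complex.Im (f p)| <= B * fine (nu S).
  apply: Rintegral_bounded_le => // p Sp.
  exact: le_trans (normc_Im _) (fB _ Sp).
have n4 (a b c d : R) : `|a - b - c + d| <= `|a| + `|b| + `|c| + `|d|.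
  rewrite (le_trans (ler_normD _ _))// ?normrN lerD//.
  rewrite (le_trans (ler_normD _ _))// ?normrN lerD//.
  by rewrite (le_trans (ler_normD _ _))// ?normrN.
have n4' (a b c d : R) : `|a - b + c - d| <= `|a| + `|b| + `|c| + `|d|.
  rewrite (le_trans (ler_normD _ _))// ?normrN lerD//.
  rewrite (le_trans (ler_normD _ _))// ?normrN lerD//.
  by rewrite (le_trans (ler_normD _ _))// ?normrN.
apply: (le_trans (lerD (n4 _ _ _ _) (n4' _ _ _ _))).
have := br (cm1 mu); have := br (cm2 mu); have := br (cm3 mu); have := br (cm4 mu).
have := bi (cm1 mu); have := bi (cm2 mu); have := bi (cm3 mu); have := bi (cm4 mu).
lra.
Qed.

(** Dominated convergence is applied to the real and imaginary parts of the functions, for each of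
    the four measures. *)
Lemma cmint_cvg0 (f_ : nat -> R * R -> R[i]) f B :
  (forall n, cmeasurable (f_ n)) -> cmeasurable f -> (forall n, bounded_by B (f_ n)) ->
  (forall p, S p -> normc (f_ n p - f p) @[n --> \oo] --> 0) ->
  (forall n, cmint mu S (f_ n) = 0) -> cmint mu S f = 0.
Proof.
move=> mf_ mf fB ff f0.
have cr (nu : {finite_measure set (R * R)%type -> \bar R}) :
    \int[nu]_(p in S) complex.Re (f_ n p) @[n --> \oo] -->
    \int[nu]_(p in S) complex.Re (f p).
  apply: (@Rintegral_cvg_bounded _ _ _ _ _ _ _ _ B) => //.
  - by move=> n; case: (mf_ n).
  - by case: mf.
  - move=> n p Sp; exact: le_trans (normc_Re _) (fB _ _ Sp).
  - move=> p Sp; apply/cvgrPdist_lt => e e0.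
    have /cvgrPdist_lt/(_ e e0) := ff p Sp; apply: filterS => n.
    rewrite sub0r normrN ger0_norm ?normc_ge0// distrC; apply: le_lt_trans.
    by rewrite (le_trans _ (normc_Re _))//; case: (f_ n p) (f p) => [? ?] [].
have ci (nu : {finite_measure set (R * R)%type -> \bar R}) :
    \int[nu]_(p in S) complex.Im (f_ n p) @[n --> \oo] -->
    \int[nu]_(p in S) complex.Im (f p).
  apply: (@Rintegral_cvg_bounded _ _ _ _ _ _ _ _ B) => //.
  - by move=> n; case: (mf_ n).
  - by case: mf.
  - move=> n p Sp; exact: le_trans (normc_Im _) (fB _ _ Sp).
  - move=> p Sp; apply/cvgrPdist_lt => e e0.
    have /cvgrPdist_lt/(_ e e0) := ff p Sp; apply: filterS => n.
    rewrite sub0r normrN ger0_norm ?normc_ge0// distrC; apply: le_lt_trans.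
    by rewrite (le_trans _ (normc_Im _))//; case: (f_ n p) (f p) => [? ?] [].
have Lr : complex.Re (cmint mu S (f_ n)) @[n --> \oo] --> complex.Re (cmint mu S f).
  by apply: cvgD => //; apply: cvgB => //; apply: cvgB.
have Li : complex.Im (cmint mu S (f_ n)) @[n --> \oo] --> complex.Im (cmint mu S f).
  by apply: cvgB => //; apply: cvgD => //; apply: cvgB.
have z (g : R[i] -> R) : g 0 = 0 -> g (cmint mu S (f_ n)) @[n --> \oo] --> (0 : R).
  by move=> g0; under eq_cvg do rewrite f0 g0; exact: cvg_cst.
apply/eqP; rewrite eq_complex/=; apply/andP; split; apply/eqP.
- exact: (cvg_unique _ Lr (z _ _)).
- exact: (cvg_unique _ Li (z _ _)).
Qed.

Lemma cmint_indic (K : set (R * R)) : measurable K -> K `<=` S ->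
  cmint mu S (fun p => (\1_K p)%:C%C) = cmval mu K.
Proof.
move=> mK KS.
have er (nu : {finite_measure set (R * R)%type -> \bar R}) :
    \int[nu]_(p in S) complex.Re (\1_K p)%:C%C = fine (nu K).
  by rewrite /Rintegral/= integral_indic// setIidl.
have ei (nu : {finite_measure set (R * R)%type -> \bar R}) :
    \int[nu]_(p in S) complex.Im (\1_K p)%:C%C = 0.
  by rewrite Rintegral_cst// mul0r.
by rewrite /cmint !er !ei /cmval subr0 addr0 subrr add0r.
Qed.

End complex_integral.

(** * Functions annihilated together with all powers of [zeta], and the limit of peak products *)

Section annihilation.
Variables (R : realType) (mu : cmeasure R) (S : set (R * R)) (zeta : R * R -> R[i]).
Hypothesis mS : measurable S.
Hypothesis mzeta : cmeasurable S zeta.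
Hypothesis zeta1 : bounded_by S 1 zeta.
Hypothesis mom0 : forall j : nat, cmint mu S (fun p => zeta p ^+ j) = 0.
Implicit Types (f : R * R -> R[i]).

(** Keeping all powers [j], and not only [j = 0], makes the property stable under multiplication by
    [zeta - a] and under division by [zeta - w] with [|w| > 1]. *)
Definition annihilated f := bmeasurable S f /\
  forall j : nat, cmint mu S (fun p => zeta p ^+ j * f p) = 0.

Let bzeta : bmeasurable S zeta.
Proof. by split => //; exists 1. Qed.

Lemma annihilated1 : annihilated (fun=> 1).
Proof.
split; first exact: bmeasurable_cst.
by move=> j; under eq_fun do rewrite mulr1; exact: mom0.
Qed.

Lemma annihilated_subM (a : R[i]) f : annihilated f ->
  annihilated (fun p => (zeta p - a) * f p).
Proof.
move=> [bf f0]; split.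
  by apply: bmeasurableM => //; apply: bmeasurableD => //; exact: bmeasurable_cst.
move=> j.
have -> : (fun p => zeta p ^+ j * ((zeta p - a) * f p)) =
    (fun p => zeta p ^+ j.+1 * f p + - a * (zeta p ^+ j * f p)).
  by apply/funext => p; rewrite exprS; ring.
rewrite cmintD// ?cmintZ//.
- by rewrite !f0 mulr0 addr0.
- by apply: bmeasurableM => //; exact: bmeasurableX.
- by apply: bmeasurableM => //; exact: bmeasurableX.
- apply: bmeasurableM; first exact: bmeasurable_cst.
  by apply: bmeasurableM => //; exact: bmeasurableX.
Qed.

(** Bernoulli's inequality [a ^+ n >= 1 + n (a - 1)] makes [a ^+ n * x] unbounded as soon as
    [x > 0]. *)
Lemma expr_bounded_eq0 (a x C : R) : 1 < a -> 0 <= x ->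
  (forall n : nat, a ^+ n * x <= C) -> x = 0.
Proof.
move=> a1 x0 axC; apply/eqP; rewrite eq_le x0 andbT leNgt; apply/negP => xp.
have bern (n : nat) : 1 + n%:R * (a - 1) <= a ^+ n.
  elim: n => [|n IH]; first by rewrite mul0r addr0 expr0.
  rewrite exprS -natr1.
  apply: le_trans (ler_wpM2l (ltW (lt_trans ltr01 a1)) IH).
  have : 0 <= n%:R * (a - 1) ^+ 2 by rewrite mulr_ge0// sqr_ge0.
  by rewrite expr2; lra.
have d0 : 0 < (a - 1) * x by rewrite mulr_gt0// subr_gt0.
have := archi_boundP (divr_ge0 (normr_ge0 C) (ltW d0)).
set n := Num.bound _; rewrite ltr_pdivrMr// => Cn.
have := axC n; have := ler_wpM2r x0 (bern n); have := ler_norm C; lra.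
Qed.

(* The moments of [f / (zeta - w)] form a geometric progression of ratio [w];
   being bounded, it vanishes. *)
Lemma annihilated_div (w : R[i]) f : 1 < normc w -> annihilated f ->
  annihilated (fun p => f p / (zeta p - w)).
Proof.
move=> w1 [bf f0].
have zw p : S p -> normc w - 1 <= normc (zeta p - w).
  move=> Sp; have := le_normcD (zeta p) (w - zeta p); rewrite addrC subrK.
  by rewrite [X in _ <= _ + X]normcBC => h; have := zeta1 Sp; lra.
have bh : bmeasurable S (fun p => f p / (zeta p - w)).
  apply: bmeasurableM => //; split.
    apply: cmeasurableV; apply: cmeasurableD => //; exact: cmeasurable_cst.
  exists (normc w - 1)^-1 => p Sp; rewrite normcV lef_pV2 ?zw ?posrE ?subr_gt0//.
  by rewrite (lt_le_trans _ (zw p Sp))// subr_gt0.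
split => //.
set h := fun p => f p / (zeta p - w).
have bzh j : bmeasurable S (fun p => zeta p ^+ j * h p).
  by apply: bmeasurableM => //; exact: bmeasurableX.
(* On [S] one has [zeta * h = w * h + f], and the moments of [f] vanish. *)
have step j : cmint mu S (fun p => zeta p ^+ j.+1 * h p) =
    w * cmint mu S (fun p => zeta p ^+ j * h p).
  rewrite -cmintZ// -[RHS]addr0 -(f0 j) -cmintD//.
  - apply: eq_cmint => p Sp; rewrite /h.
    have nz : zeta p - w != 0.
      by rewrite -normc_gt0 (lt_le_trans _ (zw p Sp))// subr_gt0.
    by rewrite -{3}[f p](mulfVK nz) exprS; ring.
  - by apply: bmeasurableM => //; exact: bmeasurable_cst.
  - by apply: bmeasurableM => //; exact: bmeasurableX.
have stepn j n : cmint mu S (fun p => zeta p ^+ (n + j) * h p) =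
    w ^+ n * cmint mu S (fun p => zeta p ^+ j * h p).
  by elim: n => [|n IH]; rewrite ?expr0 ?mul1r ?addSn ?step ?IH ?exprS ?mulrA.
move=> j; apply: eq0_normc.
have [M hM] := normc_cmint_le mu mS.
have [mh [B hB]] := bh.
(* The moment of order [n + j] is [w ^+ n] times that of order [j]; since [|zeta| <= 1] on [S], its
   modulus stays below [M * B] for every [n]. *)
apply: (@expr_bounded_eq0 (normc w) _ (M * B)) => //; first exact: normc_ge0.
move=> n; rewrite -normcX -normcM -stepn; apply: hM; first by case: (bzh (n + j)%N).
move=> p Sp; rewrite normcM normcX (le_trans _ (hB p Sp))// ler_piMl ?normc_ge0//.
by rewrite exprn_ile1 ?normc_ge0// zeta1.
Qed.

Lemma annihilated_peak (g : R[i]) (rho : R) f : normc g = 1 -> 0 < rho ->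
  annihilated f -> annihilated (fun p => peak g rho (zeta p) * f p).
Proof.
move=> g1 rho0 af; rewrite /peak.
under eq_fun do rewrite mulrAC.
apply: annihilated_div; last exact: annihilated_subM.
by rewrite normc_pole ?ltW// ltrDl.
Qed.

Lemma annihilated_prod (s : seq (R[i] * R)) f :
  {in s, forall i, normc i.1 = 1 /\ 0 < i.2} -> annihilated f ->
  annihilated (fun p => (\prod_(i <- s) peak i.1 i.2 (zeta p)) * f p).
Proof.
move=> + af; elim: s => [|i s IH] hs.
  by under eq_fun do rewrite big_nil mul1r.
under eq_fun do rewrite big_cons -mulrA.
have [g1 rho0] := hs i (mem_head _ _).
apply: annihilated_peak => //; apply: IH => j js.
by apply: hs; rewrite inE js orbT.
Qed.

Lemma annihilated_prodX (s : seq (R[i] * R)) n :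
  {in s, forall i, normc i.1 = 1 /\ 0 < i.2} ->
  annihilated (fun p => (\prod_(i <- s) peak i.1 i.2 (zeta p)) ^+ n).
Proof.
move=> hs; elim: n => [|n IH].
  by under eq_fun do rewrite expr0; exact: annihilated1.
by under eq_fun do rewrite exprS; exact: annihilated_prod.
Qed.

(** The limit of the annihilated powers is [1 - \1_K], whose integral is [- cmval mu K] because [1]
    integrates to [0]. For convergence off [K] the discs must move away from [zeta p]: [zeta p] has
    positive distance to the image of [K], and each disc of the cover meets that image. *)
Lemma cmval_eq0_of_covers (K : set (R * R)) : measurable K -> K `<=` S ->
  (forall p, S p -> ~ K p ->
    exists2 d : R, 0 < d & forall q, K q -> d <= normc (zeta p - zeta q)) ->
  (forall e : R, 0 < e -> exists s : seq (R[i] * R),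
    [/\ {in s, forall i, normc i.1 = 1 /\ 0 < i.2}, \sum_(i <- s) i.2 <= e,
        forall q, K q -> exists2 i, i \in s & normc (zeta q - i.1) <= i.2 &
        {in s, forall i, exists2 q, K q & normc (zeta q - i.1) <= i.2}]) ->
  cmval mu K = 0.
Proof.
move=> mK KS sep cov.
(* The square matters: raising to the power [m.+1] multiplies the distance to [1] by at most [m.+1],
   which leaves a bound of order [1 / m.+1]. *)
have e0 (m : nat) : 0 < m.+1%:R^-1 ^+ 2 :> R by rewrite exprn_gt0// invr_gt0.
pose s m := sval (cid (cov _ (e0 m))).
have sP m : [/\ {in s m, forall i, normc i.1 = 1 /\ 0 < i.2},
    \sum_(i <- s m) i.2 <= m.+1%:R^-1 ^+ 2,
    forall q, K q -> exists2 i, i \in s m & normc (zeta q - i.1) <= i.2 &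
    {in s m, forall i, exists2 q, K q & normc (zeta q - i.1) <= i.2}].
  exact: (svalP (cid (cov _ (e0 m)))).
pose P m p := \prod_(i <- s m) peak i.1 i.2 (zeta p).
have ann m : annihilated (fun p => P m p ^+ m.+1).
  by apply: annihilated_prodX; case: (sP m).
have peak1 m p : S p -> {in s m, forall i, normc (peak i.1 i.2 (zeta p)) <= 1}.
  move=> Sp i im; have [/(_ i im)[g1 r0] _ _ _] := sP m.
  by apply: normc_peak_le1 => //; exact: zeta1.
have P1 m p : S p -> normc (P m p) <= 1.
  by move=> Sp; apply: normc_prod_le1; exact: peak1.
have b1K : bmeasurable S (fun p => (\1_K p)%:C%C).
  split; last first.
    exists 1 => p _; rewrite normcR indicE; case: (_ \in _) => /=;
    by rewrite ?normr1 ?normr0.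
  by split => /=; [exact: measurable_indic|exact: measurable_cst].
have b1K' : bmeasurable S (fun p => -1 * (\1_K p)%:C%C).
  by apply: bmeasurableM => //; exact: bmeasurable_cst.
have L1 : cmint mu S (fun=> 1) = 0.
  by rewrite -[RHS](mom0 0); under [in RHS]eq_fun do rewrite expr0.
suff : cmint mu S (fun p => 1 + -1 * (\1_K p)%:C%C) = 0.
  rewrite cmintD ?cmintZ//; last exact: bmeasurable_cst.
  by rewrite L1 add0r mulN1r cmint_indic// => /eqP; rewrite oppr_eq0 => /eqP.
apply: (@cmint_cvg0 _ _ _ mS (fun m p => P m p ^+ m.+1) _ 1).
- by move=> m; case: (ann m) => -[].
- by apply: cmeasurableD; [exact: cmeasurable_cst|case: b1K'].
- by move=> m p Sp; rewrite normcX exprn_ile1 ?normc_ge0// P1.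
- move=> p Sp; have [Kp|nKp] := pselect (K p).
    rewrite indicE mem_set//= mulN1r subrr.
    (* A disc containing [zeta p] contributes a factor of modulus at most [1 / sqrt 2]; [3 / 4] is a
       rational bound for it that is still below [1]. *)
    have P34 m : normc (P m p) <= 3 / 4.
      have [hs _ /(_ p Kp)[i im zi] _] := sP m.
      have [g1 r0] := hs i im.
      have x2 := sqr_normc_peak_le_half g1 r0 (zeta1 Sp) zi.
      rewrite /P (big_rem i)//= normcM.
      apply: (@le_trans _ _ (normc (peak i.1 i.2 (zeta p)))).
        rewrite ler_piMr ?normc_ge0//; apply: normc_prod_le1 => j /mem_rem js.
        exact: (peak1 m).
      have := normc_ge0 (peak i.1 i.2 (zeta p)); nra.
    apply: (@squeeze_cvgr _ _ _ _ (cst 0) (fun m => (3 / 4) ^+ m)).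
    + apply: nearW => m; rewrite subr0 normc_ge0/= normcX.
      rewrite (@le_trans _ _ (normc (P m p) ^+ m))//.
        by rewrite exprS ler_piMl ?exprn_ge0 ?normc_ge0// P1.
      by rewrite lerXn2r// nnegrE ?normc_ge0//; lra.
    + exact: cvg_cst.
    + by apply: cvg_expr; rewrite ger0_norm; lra.
  have [d d0 dK] := sep p Sp nKp.
  rewrite indicE memNset//= mulr0 addr0.
  apply/cvgrPdist_lt => e ep.
  (* With [t = 1 / m.+1], the bound [t < d / 2] keeps every centre at distance at least [d / 2] from
     [zeta p], and [t < e * d / 2] makes the final estimate [2 / d * t] less than [e]. *)
  have D0 : 0 < Num.min (d / 2) (e * d / 2).
    by rewrite lt_min !divr_gt0// mulr_gt0.
  have := near_infty_natSinv_lt (PosNum D0); apply: filterS => m /=.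
  rewrite lt_min => /andP[md me].
  rewrite sub0r normrN ger0_norm ?normc_ge0// normcBC.
  set t := m.+1%:R^-1 : R in md me.
  have t0 : 0 < t by rewrite invr_gt0.
  have t1 : t <= 1 by rewrite invf_le1// ler1n.
  have [hs sume _ meet] := sP m.
  apply: le_lt_trans (normc_1subX _ (P1 m p Sp)) _.
  have : normc (1 - P m p) <= 2 / d * t ^+ 2.
    rewrite (le_trans (normc_1sub_prod (peak1 m p Sp)))//.
    apply: (@le_trans _ _ (\sum_(i <- s m) (2 / d * i.2))); last first.
      by rewrite -mulr_sumr ler_wpM2l// divr_ge0// ltW.
    rewrite big_seq [leRHS]big_seq; apply: ler_sum => i im.
    have [g1 r0] := hs i im; have [q Kq qi] := meet i im.
    rewrite normc_1sub_peak ?zeta1// [leRHS]mulrC ler_pM2l//.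
    rewrite -(invf_div d 2) lef_pV2 ?posrE ?divr_gt0 ?normc_sub_pole_gt0 ?zeta1//.
    rewrite (le_trans _ (normc_sub_pole_ge g1 r0 (zeta1 Sp)))//.
    (* A single radius is at most the sum of all radii, hence at most [t ^+ 2 <= t]. *)
    have it : i.2 <= t.
      apply: (@le_trans _ _ (t ^+ 2)); last by rewrite expr2 ler_piMl // ltW.
      apply: le_trans sume; rewrite (big_rem i)//= lerDl.
      by rewrite big_seq sumr_ge0// => j /mem_rem /hs[_ /ltW].
    have := dK q Kq; have := le_normcD (zeta p - i.1) (i.1 - zeta q).
    rewrite addrA subrK [normc (i.1 - _)]normcBC; lra.
  move=> h; apply: (@le_lt_trans _ _ (2 / d * t)).
    have -> : 2 / d * t = m.+1%:R * (2 / d * t ^+ 2).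
      by rewrite expr2 mulrCA (mulrA _ t t) mulfV// mul1r.
    by rewrite ler_wpM2l.
  by rewrite mulrC mulrA ltr_pdivrMr// -ltr_pdivlMr.
- by move=> m; case: (ann m) => _ /(_ 0); under eq_fun do rewrite expr0 mul1r.
Qed.

End annihilation.

(** * Approximation of measurable sets by closed and open sets *)

Section closed_regularity.
Variables (R : realType) (nu : {finite_measure set (R * R)%type -> \bar R}).
Implicit Types (A B C U : set (R * R)).

(* Asking for measurable [C] and [U] avoids comparing the product sigma-algebra
   with the Borel sets of the product topology. *)
Definition closed_regular B := measurable B /\ forall e : R, 0 < e ->
  exists C U, [/\ closed C, measurable C, open U & measurable U] /\
    [/\ C `<=` B, B `<=` U & (nu (U `\` C) < e%:E)%E].

(** Continuity from above along the decreasing sets [A \ C n], which have finite measure. *)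
Lemma measure_setD_bigcup_lt A (C : nat -> set (R * R)) (e : R) :
  measurable A -> (forall n, measurable (C n)) ->
  (forall n m, (n <= m)%N -> C n `<=` C m) ->
  (nu (A `\` \bigcup_n C n) < e%:E)%E -> exists n, (nu (A `\` C n) < e%:E)%E.
Proof.
move=> mA mC ndC.
have -> : A `\` \bigcup_n C n = \bigcap_n (A `\` C n).
  apply/seteqP; split => [x [Ax nC] n _|x h].
    by split => // Cx; apply: nC; exists n.
  by split; [have [] := h 0%N I|move=> [n _ Cx]; have [] := h n I].
move=> lt_e.
have mD n : measurable (A `\` C n) by exact: measurableD.
have : nu (A `\` C n) @[n --> \oo] --> nu (\bigcap_n (A `\` C n)).
  apply: nonincreasing_cvg_mu => //.
  - by rewrite ltey_eq fin_num_measure.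
  - exact: bigcapT_measurable.
  - by move=> n m nm; apply/subsetPset => x [Ax nC]; split => // /(ndC _ _ nm).
have nb : nbhs (nu (\bigcap_n (A `\` C n))) [set y | (y < e%:E)%E].
  by apply: open_nbhs_nbhs; split => //; exact: open_ereal_lt_ereal.
move=> /(_ _ nb)[n _ h].
by exists n; exact: (h n (leqnn n)).
Qed.

(** Complementation exchanges the inner closed set and the outer open set. For a countable union the
    open sets are united, and the union of the closed ones is cut to a finite one by continuity from
    above. *)
Lemma sigma_algebra_closed_regular : sigma_algebra setT closed_regular.
Proof.
split.
- split => // e e0; exists set0, set0; split; split => //.
  + exact: closed0.
  + by rewrite setD0 measure0 lte_fin.
- move=> A [mA regA]; rewrite setTD; split; first exact: measurableC.
  move=> e e0; have [C [U [[cC mC oU mU] [CA AU lt]]]] := regA e e0.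
  exists (~` U), (~` C); split; split.
  + exact: open_closedC.
  + exact: measurableC.
  + exact: closed_openC.
  + exact: measurableC.
  + exact: subsetC.
  + exact: subsetC.
  + by rewrite setDE setCK setIC -setDE.
- move=> A regA; split; first by apply: bigcupT_measurable => n; case: (regA n).
  move=> e e0.
  (* The errors add up to at most [e / 2]; halving [e] turns this into the strict bound required. *)
  have en n : 0 < e / 2 / (2 ^ n.+1)%:R by rewrite !divr_gt0// ltr0n expn_gt0.
  have /choice[CU CUP] n : exists CU : set (R * R) * set (R * R),
      [/\ closed CU.1, measurable CU.1, open CU.2 & measurable CU.2] /\
      [/\ CU.1 `<=` A n, A n `<=` CU.2 &
        (nu (CU.2 `\` CU.1) < (e / 2 / (2 ^ n.+1)%:R)%:E)%E].
    have [_ /(_ _ (en n))[C [U h]]] := regA n.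
    by exists (C, U).
  pose U := \bigcup_n (CU n).2.
  (* Finite unions, because a countable union of closed sets need not be closed. *)
  pose C n := \big[setU/set0]_(i < n.+1) (CU i).1.
  have mU : measurable U by apply: bigcupT_measurable => n; case: (CUP n) => -[].
  have mC n : measurable (C n).
    by apply: bigsetU_measurable => i _; case: (CUP i) => -[].
  have CE : \bigcup_n C n = \bigcup_n (CU n).1 by exact: bigcup_bigsetU_bigcup.
  have [N hN] : exists N, (nu (U `\` C N) < e%:E)%E.
    apply: (@measure_setD_bigcup_lt _ C) => //.
      move=> n m nm; rewrite /C -!(bigcup_mkord _ (fun i => (CU i).1)) => x [i /= im Cix].
      by exists i => //=; rewrite (leq_trans im).
    apply: (@le_lt_trans _ _ (\sum_(0 <= n <oo) nu ((CU n).2 `\` (CU n).1))%E).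
      apply: measure_sigma_subadditive.
      + by move=> n; case: (CUP n) => -[? ? ? ?] _; exact: measurableD.
      + by apply: measurableD => //; exact: bigcupT_measurable.
      + rewrite CE => x [[n _ Unx] nC]; exists n => //; split => // Cnx.
        by apply: nC; exists n.
    apply: (@le_lt_trans _ _ (\sum_(0 <= n <oo) (0 + (e / 2 / (2 ^ n.+1)%:R)%:E))%E).
      apply: lee_nneseries => // n _; rewrite add0e; apply: ltW.
      by case: (CUP n) => _ [].
    apply: le_lt_trans; first by apply: epsilon_trick => //; exact/ltW/divr_gt0.
    by rewrite eseries0// add0e lte_fin gtr_pMr// invf_lt1// ltr1n.
  exists (C N), U; split; split => //.
  + by apply: closed_bigsetU => i _; case: (CUP i) => -[].
  + by apply: bigcup_open => n _; case: (CUP n) => -[].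
  + move=> x; rewrite /C => CNx.
    have : (\bigcup_n C n) x by exists N.
    by rewrite CE => -[n _ Cnx]; exists n => //; case: (CUP n) => _ [h _ _]; exact: h.
  + by apply: subset_bigcup => n _; case: (CUP n) => _ [].
Qed.

(** The preimage is open, and it is exhausted by the closed preimages of the rays starting at
    [a + 1 / n.+1]. *)
Lemma closed_regular_ray (f : R * R -> R) (a : R) : continuous f ->
  measurable_fun setT f -> closed_regular (f @^-1` `]a, +oo[).
Proof.
move=> cf mf.
have mray (I : interval R) : measurable (f @^-1` [set` I]).
  by rewrite -[X in measurable X]setTI; exact: mf.
split => // e e0.
pose C n := f @^-1` `[a + n.+1%:R^-1, +oo[%classic.
have [n nP] : exists n, (nu ((f @^-1` `]a, +oo[) `\` C n) < e%:E)%E.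
  apply: measure_setD_bigcup_lt => //; first by move=> n; exact: mray.
  - move=> n m nm x; rewrite /C /= !in_itv/= !andbT; apply: le_trans.
    by rewrite lerD2l lef_pV2 ?posrE// ler_nat.
  - rewrite (_ : _ `\` _ = set0) ?measure0 ?lte_fin//.
    rewrite -subset0 => x [] /=; rewrite in_itv/= andbT => ax; apply.
    have d0 : 0 < f x - a by rewrite subr_gt0.
    have [n _ /(_ n (leqnn n))/= h] := near_infty_natSinv_lt (PosNum d0).
    by exists n => //; rewrite /C/= in_itv/= andbT; rewrite -lerBrDl ltW.
exists (C n), (f @^-1` `]a, +oo[); split; split => //.
- apply: preimage_closed => [x _|]; first exact: cf.
  exact: itv_closed_ends_closed.
- exact: mray.
- by apply: open_comp => [x _|]; [exact: cf|exact: interval_open].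
- move=> x; rewrite /C /= !in_itv/= !andbT; apply: lt_le_trans.
  by rewrite ltrDl invr_gt0.
Qed.

(** Open rays generate the Borel sets of the line, and the sets with regular preimage form a
    sigma-algebra. *)
Lemma closed_regular_preimage (f : R * R -> R) (B : set R) : continuous f ->
  measurable_fun setT f -> measurable B -> closed_regular (f @^-1` B).
Proof.
move=> cf mf; have [r0 rC rU] := sigma_algebra_closed_regular.
have -> : (measurable : set (set R)) = <<s RGenOInfty.G (R:=R) >>.
  exact: RGenOInfty.measurableE.
move: B; apply: smallest_sub.
  split.
  - by rewrite preimage_set0.
  - by move=> A /rC; rewrite !setTD preimage_setC.
  - by move=> A rA; rewrite preimage_bigcup; exact: rU.
by move=> _ [a ->]; exact: closed_regular_ray.
Qed.

(** The product sigma-algebra is generated by preimages under the two coordinate projections, which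
    are continuous. *)
Lemma measurable_closed_regular B : measurable B -> closed_regular B.
Proof.
move: B; apply: smallest_sub; first exact: sigma_algebra_closed_regular.
rewrite subUset; split => _ [A mA <-]; rewrite setTI.
- by apply: closed_regular_preimage => // x; exact: cvg_fst.
- by apply: closed_regular_preimage => // x; exact: cvg_snd.
Qed.

End closed_regularity.

(** * Null sets on a circle and their covers by discs *)

Section thin_sets.
Variable R : realType.
Implicit Types (p q c : R * R) (F K : set (R * R)) (r e : R).

Definition cdist p q : R := normc (toC p - toC q).

Definition disc c rho : set (R * R) := [set p | cdist p c < rho].

Lemma cdistE p q : cdist p q = Num.sqrt ((p.1 - q.1) ^+ 2 + (p.2 - q.2) ^+ 2).
Proof. by []. Qed.

Lemma continuous_cdist c : continuous (cdist^~ c).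
Proof.
move=> p; under eq_fun do rewrite cdistE !expr2.
have c1 : q.1 - c.1 @[q --> p] --> p.1 - c.1.
  by apply: cvgB; [exact: cvg_fst|exact: cvg_cst].
have c2 : q.2 - c.2 @[q --> p] --> p.2 - c.2.
  by apply: cvgB; [exact: cvg_snd|exact: cvg_cst].
apply: (cvg_comp _ (@Num.sqrt R)); last exact: sqrt_continuous.
by apply: cvgD; exact: cvgM.
Qed.

Lemma measurable_cdist c : measurable_fun setT (cdist^~ c).
Proof.
under eq_fun do rewrite cdistE.
apply: (@measurableT_comp _ _ _ _ _ _ (@Num.sqrt R)).
  by apply: continuous_measurable_fun; exact: sqrt_continuous.
by apply: measurable_funD; apply: measurable_funX; apply: measurable_funB;
  [exact: measurable_fst|exact: measurable_cst|exact: measurable_snd|exact: measurable_cst].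
Qed.

Lemma open_disc c rho : open (disc c rho).
Proof.
rewrite (_ : disc c rho = cdist^~ c @^-1` `]-oo, rho[).
  by apply: open_comp => [p _|]; [exact: continuous_cdist|exact: interval_open].
by apply/seteqP; split => p; rewrite /disc/= in_itv.
Qed.

Lemma measurable_disc c rho : measurable (disc c rho).
Proof.
rewrite (_ : disc c rho = setT `&` cdist^~ c @^-1` `]-oo, rho[).
  exact: measurable_cdist.
by rewrite setTI; apply/seteqP; split => p; rewrite /disc/= in_itv.
Qed.

Lemma measurable_circle r : measurable (@circle R r).
Proof.
rewrite (_ : circle r = setT `&` (fun p => p.1 ^+ 2 + p.2 ^+ 2) @^-1` [set r ^+ 2]).
  suff : measurable_fun setT (fun p : R * R => p.1 ^+ 2 + p.2 ^+ 2) by exact.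
  by apply: measurable_funD; apply: measurable_funX;
    [exact: measurable_fst|exact: measurable_snd].
by rewrite setTI.
Qed.

Lemma closed_circle_compact r K : 0 < r -> closed K -> K `<=` circle r -> compact K.
Proof.
move=> r0 cK Kr; apply: (@subclosed_compact _ _ (`[- r, r] `*` `[- r, r])) => //.
  by apply: compact_setX; exact: segment_compact.
move=> p /Kr; rewrite /circle/= => pr; split => /=; rewrite in_itv/= -ler_norml;
  rewrite -(@ler_pXn2r _ 2)// ?nnegrE ?(ltW r0)// real_normK ?num_real// -pr.
- by rewrite lerDl sqr_ge0.
- by rewrite lerDr sqr_ge0.
Qed.

(** [acos] takes values in [[0, pi]], so it gives the angle on the upper half; on the lower half the
    angle is [2 * pi] minus it. *)
Lemma circle_param r p : 0 < r -> circle r p ->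
  exists2 t, t \in `[0, 2 * pi] & p = (r * cos t, r * sin t).
Proof.
case: p => a b r0; rewrite /circle/= => pr.
pose x := a / r; pose y := b / r.
have ax : a = r * x by rewrite mulrC divfK// gt_eqF.
have yb : b = r * y by rewrite mulrC divfK// gt_eqF.
have xy : x ^+ 2 + y ^+ 2 = 1.
  by rewrite !expr_div_n -mulrDl pr divff// expf_eq0 gt_eqF.
have x1 : -1 <= x <= 1.
  by rewrite -ler_norml -(@ler_pXn2r _ 2)// ?nnegrE// real_normK ?num_real//
    expr1n -xy lerDl sqr_ge0.
have y2 : 1 - x ^+ 2 = y ^+ 2 by rewrite -xy addrAC subrr add0r.
have ac0 := acos_ge0 x1; have acpi := acos_lepi x1; have pi0 := pi_ge0 R.
have [y0|y0] := leP 0 y.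
  exists (acos x).
    by rewrite in_itv/= ac0 (le_trans acpi)// ler_peMl// ler1n.
  by rewrite acosK// sin_acos// y2 sqrtr_sqr ger0_norm// -ax -yb.
exists (2 * pi - acos x).
  by rewrite in_itv/= subr_ge0 lerBlDr lerDl ac0 andbT (le_trans acpi)// ler_peMl// ler1n.
have -> : 2 * pi - acos x = - acos x + pi *+ 2 by rewrite addrC mulr_natl.
rewrite cosD2pi sinD2pi cosN sinN acosK// sin_acos// y2 sqrtr_sqr ltr0_norm//.
by rewrite opprK -ax -yb.
Qed.

(** By the mean value theorem [cos] and [sin] are 1-Lipschitz; the factor [2] comes from bounding
    the modulus by the sum of the two coordinates. *)
Lemma arc_cdist_le r a t : 0 <= r -> a <= t ->
  cdist (r * cos t, r * sin t) (r * cos a, r * sin a) <= 2 * r * (t - a).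
Proof.
move=> r0 at_.
have lip (f df : R -> R) : (forall x : R, is_derive x (1 : R) f (df x)) ->
    (forall x, `|df x| <= 1) -> `|f t - f a| <= t - a.
  move=> hd hb; have [|c _ ->] := @MVT_segment R f df a t at_ (fun x _ => hd x).
    apply: derivable_within_continuous => x _; exact: ex_derive.
  by rewrite normrM (@ger0_norm _ (t - a)) ?subr_ge0// ler_piMl// subr_ge0.
have hc : `|cos t - cos a| <= t - a.
  apply: (lip _ (fun x => - sin x)) => x.
  by rewrite normrN ler_norml sin_geN1 sin_le1.
have hs : `|sin t - sin a| <= t - a.
  apply: (lip _ cos) => x.
  by rewrite ler_norml cos_geN1 cos_le1.
rewrite /cdist (le_trans (normc_le_sum _))//= -!mulrBr !normrM ger0_norm//.
rewrite -mulrDr (mulrC 2) -mulrA ler_wpM2l// mulr2n mulrDl mul1r.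
exact: lerD.
Qed.

(** Vanishing one-dimensional Hausdorff measure, with discs centred on the circle. Radius [0] is
    allowed and gives an empty disc; bounding partial sums keeps the total in [R]. *)
Definition thin r F := forall e, 0 < e -> exists (c : nat -> R * R) (rho : nat -> R),
  [/\ forall k, circle r (c k), forall k, 0 <= rho k,
      forall n, \sum_(k < n) rho k <= e & F `<=` \bigcup_k disc (c k) (rho k)].

(** The null set of angles is covered by open intervals of total length below [e / (2 * r)]. An
    interval of length [l] yields a disc of radius [2 * r * l] about the image of its left
    endpoint. *)
Lemma arclength_null_thin r F : 0 < r -> arclength_null r (F `&` circle r) ->
  thin r (F `&` circle r).
Proof.
move=> r0 /negligible_outer_measure N0 e e0.
set N := [set t | _] in N0.
have e1 : 0 < e / (2 * r) by rewrite divr_gt0// mulr_gt0.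
move: N0; rewrite outer_measure_open_itv_cover => N0.
have : (ereal_inf [set (\sum_(k <oo) wlength idfun (J k))%E | J in open_itv_cover N]
    < (e / (2 * r))%:E)%E by rewrite N0 lte_fin.
move=> /ereal_inf_lt[_ [J [Jitv NJ] <-] Jlt].
have /choice[ab abE] k : exists ab : R * R, J k = `]ab.1, ab.2[%classic.
  by have [ab ->] := Jitv k; exists ab.
(* The endpoints may come in the wrong order; the interval is then empty and has length [0]. *)
pose len k := Num.max 0 ((ab k).2 - (ab k).1).
have len0 k : 0 <= len k by rewrite le_max lexx.
have lenE k : wlength idfun (J k) = (len k)%:E.
  rewrite abE wlength_itv/= lte_fin /len; case: ltP => h.
    by rewrite max_r ?subr_ge0 ?ltW// EFinB.
  by rewrite max_l// subr_le0.
exists (fun k => (r * cos (ab k).1, r * sin (ab k).1)), (fun k => 2 * r * len k).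
split.
- move=> k; rewrite /circle/= !exprMn -mulrDr cos2Dsin2 mulr1//.
- by move=> k; rewrite !mulr_ge0// ltW.
- move=> n; rewrite -mulr_sumr mulrC -ler_pdivlMr ?mulr_gt0//.
  rewrite -lee_fin (le_trans _ (ltW Jlt))// -sumEFin.
  under eq_bigr do rewrite -lenE.
  rewrite -(big_mkord xpredT (fun k => wlength idfun (J k))).
  by apply: nneseries_lim_ge => k _ _; rewrite lenE lee_fin.
- move=> p [Fp pr].
  have [t t02 ptE] := circle_param r0 pr.
  have Nt : N t by split => //; rewrite -ptE.
  have [k _] := NJ t Nt; rewrite abE/= in_itv/= => /andP[at_ tb].
  exists k => //; rewrite /disc/= ptE.
  apply: le_lt_trans (arc_cdist_le (ltW r0) (ltW at_)) _.
  rewrite ltr_pM2l ?mulr_gt0// /len lt_max; apply/orP; right.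
  by rewrite ltrD2r.
Qed.

Lemma thin_sub r F K : K `<=` F -> thin r F -> thin r K.
Proof.
move=> KF tF e /tF[c [rho [cr rho0 sume Fc]]]; exists c, rho; split => //.
exact: subset_trans Fc.
Qed.

(** Intersecting, over all [n], the open covers of total radius at most [1 / n.+1] gives a
    measurable set that is still thin. This deals with sets that are not assumed measurable. *)
Lemma thin_measurable_cover r F : F `<=` circle r -> thin r F ->
  exists G, [/\ measurable G, F `<=` G, G `<=` circle r & thin r G].
Proof.
move=> Fr tF.
have e0 (n : nat) : 0 < n.+1%:R^-1 :> R by rewrite invr_gt0.
have /choice[cr crP] n : exists cr : nat -> (R * R) * R,
    [/\ forall k, circle r (cr k).1, forall k, 0 <= (cr k).2,
      forall m, \sum_(k < m) (cr k).2 <= n.+1%:R^-1 &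
      F `<=` \bigcup_k disc (cr k).1 (cr k).2].
  have [c [rho h]] := tF _ (e0 n).
  by exists (fun k => (c k, rho k)).
exists (circle r `&` \bigcap_n \bigcup_k disc (cr n k).1 (cr n k).2); split.
- apply: measurableI; first exact: measurable_circle.
  apply: bigcapT_measurable => n; apply: bigcupT_measurable => k.
  exact: measurable_disc.
- by move=> p Fp; split; [exact: Fr|move=> n _; case: (crP n) => _ _ _; exact].
- exact: subIsetl.
- move=> e ep.
  have [n _ /(_ n (leqnn n))/= ne] := near_infty_natSinv_lt (PosNum ep).
  have [h1 h2 h3 h4] := crP n.
  exists (fun k => (cr n k).1), (fun k => (cr n k).2); split => //.
    by move=> m; rewrite (le_trans (h3 m))// ltW.
  by move=> p [_ /(_ n I)].
Qed.

Lemma thin_finite_cover r K e : 0 < r -> closed K -> K `<=` circle r -> thin r K ->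
  0 < e -> exists s : seq ((R * R) * R),
  [/\ {in s, forall i, circle r i.1 /\ 0 < i.2}, \sum_(i <- s) i.2 <= e,
      forall q, K q -> exists2 i, i \in s & cdist q i.1 <= i.2 &
      {in s, forall i, exists2 q, K q & cdist q i.1 <= i.2}].
Proof.
move=> r0 cK Kr tK e0; have [c [rho [cr rho0 sume Kc]]] := tK e e0.
(* Compactness in near-covering form: around each point one disc works for all large [N], so one [N]
   serves all of [K]. *)
have [N _ KN] : \forall N \near \oo,
    K `<=` [set q | exists2 k, (k < N)%N & disc (c k) (rho k) q].
  have /compact_near_coveringP := closed_circle_compact r0 cK Kr; apply.
  move=> q /Kc[k _ qk].
  exists (disc (c k) (rho k), [set N | (k < N)%N]); last first.
    by move=> [q' N] [/= q'k kN]; exists k.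
  split; last by exists k.+1.
  by apply: open_nbhs_nbhs; split => //; exact: open_disc.
(* Discs that miss [K] are discarded; those that remain have positive radius. *)
pose meets k := `[< exists2 q, K q & cdist q (c k) < rho k >].
pose s := [seq (c k, rho k) | k <- [seq k <- iota 0 N | meets k]].
exists s; split.
- move=> _ /mapP[k + ->]; rewrite mem_filter => /andP[/asboolP[q Kq qk] _] /=.
  by split => //; apply: le_lt_trans qk; exact: normc_ge0.
- rewrite big_map big_filter; apply: le_trans (sume N).
  rewrite -(big_mkord xpredT rho) /index_iota subn0 big_mkcond/=.
  by apply: ler_sum => k _; case: ifP.
- move=> q Kq; have [k kN qk] := KN N (leqnn N) q Kq; exists (c k, rho k); last exact/ltW.
  apply/mapP; exists k => //; rewrite mem_filter mem_iota/= add0n kN andbT.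
  by apply/asboolP; exists q.
- move=> _ /mapP[k + ->]; rewrite mem_filter => /andP[/asboolP[q Kq qk] _] /=.
  by exists q => //; exact/ltW.
Qed.

End thin_sets.

(** * Vanishing of the measure on thin subsets of one circle *)

Section thin_null.
Variables (R : realType) (mu : cmeasure R) (S : set (R * R)) (r : R).
Variable zeta : R * R -> R[i].
Hypothesis r0 : 0 < r.
Hypothesis mS : measurable S.
Hypothesis rS : circle r `<=` S.
Hypothesis mzeta : cmeasurable S zeta.
Hypothesis zeta1 : bounded_by S 1 zeta.
Hypothesis mom0 : forall j : nat, cmint mu S (fun p => zeta p ^+ j) = 0.
Hypothesis zeta_circle : forall p, circle r p -> normc (zeta p) = 1.
Hypothesis zeta_expand : forall p q, S p -> circle r q ->
  cdist p q <= normc (zeta p - zeta q).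
Hypothesis zeta_lip : forall p q, circle r p -> circle r q ->
  normc (zeta p - zeta q) <= cdist p q / r.

Lemma cmval_closed_thin (K : set (R * R)) : measurable K -> closed K ->
  K `<=` circle r -> thin r K -> cmval mu K = 0.
Proof.
move=> mK cK Kr tK; apply: (cmval_eq0_of_covers mS mzeta zeta1 mom0) => //.
- exact: subset_trans rS.
- move=> p Sp nKp.
  have : nbhs p (~` K) by apply: open_nbhs_nbhs; split => //; exact: closed_openC.
  move=> /nbhs_ballP[d /= d0 dK]; exists d => // q Kq.
  apply: le_trans (zeta_expand Sp (Kr _ Kq)).
  (* Balls of the product are squares, and each coordinate difference is at most the Euclidean
     distance. *)
  rewrite leNgt; apply/negP => pq; apply: (dK q) => //; split.
  + exact: le_lt_trans (normc_Re _) pq.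
  + exact: le_lt_trans (normc_Im _) pq.
(* The map [zeta] scales radii by [1 / r], so a cover of total radius [e * r] is taken in the
   plane. *)
- move=> e e0; have [s [s1 s2 s3 s4]] := thin_finite_cover r0 cK Kr tK (mulr_gt0 e0 r0).
  exists [seq (zeta i.1, i.2 / r) | i <- s]; split.
  + move=> _ /mapP[i /s1[ci ri] ->] /=.
    by split; [exact: zeta_circle|exact: divr_gt0].
  + by rewrite big_map/= -mulr_suml ler_pdivrMr.
  + move=> q Kq; have [i si qi] := s3 q Kq.
    exists (zeta i.1, i.2 / r); first by apply/mapP; exists i.
    rewrite (le_trans (zeta_lip (Kr _ Kq) _))//=; first by case: (s1 i si).
    by rewrite ler_pM2r// invr_gt0.
  + move=> _ /mapP[i si ->] /=; have [q Kq qi] := s4 i si.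
    exists q => //; rewrite (le_trans (zeta_lip (Kr _ Kq) _))//=; first by case: (s1 i si).
    by rewrite ler_pM2r// invr_gt0.
Qed.

(** A thin set need not be closed, so it is approximated from inside by closed sets, on which [mu]
    vanishes. *)
Lemma cmval_thin (B : set (R * R)) : measurable B ->
  B `<=` circle r -> thin r B -> cmval mu B = 0.
Proof.
move=> mB Br tB.
have approx (e : R) : 0 < e -> exists K : set (R * R), [/\ measurable K, K `<=` B, cmval mu K = 0 &
    [/\ (cm1 mu (B `\` K) <= e%:E)%E, (cm2 mu (B `\` K) <= e%:E)%E,
        (cm3 mu (B `\` K) <= e%:E)%E & (cm4 mu (B `\` K) <= e%:E)%E]].
  move=> e0.
  have inner (nu : {finite_measure set (R * R)%type -> \bar R}) :
      exists K : set (R * R), [/\ closed K, measurable K, K `<=` B & (nu (B `\` K) <= e%:E)%E].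
    have [_ /(_ e e0)[C [U [[cC mC _ mU] [CB BU lt]]]]] :=
      measurable_closed_regular nu mB.
    exists C; split => //; apply: le_trans (ltW lt).
    by apply: le_measure; rewrite ?inE; [exact: measurableD|exact: measurableD|exact: setSD].
  have [K1 [c1 m1 s1 l1]] := inner (cm1 mu).
  have [K2 [c2 m2 s2 l2]] := inner (cm2 mu).
  have [K3 [c3 m3 s3 l3]] := inner (cm3 mu).
  have [K4 [c4 m4 s4 l4]] := inner (cm4 mu).
  (* The union of the four closed sets is a good approximation for all four measures at once. *)
  pose K := K1 `|` K2 `|` (K3 `|` K4).
  have mK : measurable K by apply: measurableU; exact: measurableU.
  have cK : closed K by apply: closedU; exact: closedU.
  have KB : K `<=` B by rewrite !subUset.
  have le (nu : {finite_measure set (R * R)%type -> \bar R}) Ki : measurable Ki ->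
      Ki `<=` K -> (nu (B `\` Ki) <= e%:E)%E -> (nu (B `\` K) <= e%:E)%E.
    move=> mKi KiK; apply: le_trans; apply: le_measure; rewrite ?inE.
    - exact: measurableD.
    - exact: measurableD.
    - exact: setDS.
  exists K; split => //.
    by apply: cmval_closed_thin => //; [exact: subset_trans Br|exact: thin_sub tB].
  split.
  - by apply: le l1 => // p ?; left; left.
  - by apply: le l2 => // p ?; left; right.
  - by apply: le l3 => // p ?; right; left.
  - by apply: le l4 => // p ?; right; right.
have split_fine (nu : {finite_measure set (R * R)%type -> \bar R}) K e :
    measurable K -> K `<=` B -> (nu (B `\` K) <= e%:E)%E ->
    fine (nu K) <= fine (nu B) <= fine (nu K) + e.
  move=> mK KB le_e; have mBK : measurable (B `\` K) by exact: measurableD.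
  have fnu A : measurable A -> nu A \is a fin_num by exact: fin_num_measure.
  have -> : nu B = (nu K + nu (B `\` K))%E.
    rewrite -measureU//; first by rewrite setDUK.
    by rewrite setDE setICA setICr setI0.
  rewrite fineD ?fnu// lerDl lerD2l fine_ge0 ?measure_ge0//=.
  by rewrite -lee_fin fineK// fnu.
have eq_of_le (x y : R) : (forall e, 0 < e -> `|x - y| <= e) -> x - y = 0.
  move=> h; apply/eqP; rewrite -normr_le0; apply/ler_addgt0Pr => e e0.
  by rewrite add0r h.
(* On [K] the two measures of each pair agree, and passing to [B] raises each of them by at most
   [e]; so their values at [B] differ by at most [e]. *)
rewrite /cmval; apply/eqP; rewrite eq_complex/=; apply/andP; split; apply/eqP;
  apply: eq_of_le => e e0; have [K [mK KB /eqP + [l1 l2 l3 l4]]] := approx e e0;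
  rewrite /cmval eq_complex/= => /andP[/eqP v1 /eqP v2].
- have /andP[a1 a2] := split_fine _ _ _ mK KB l1.
  have /andP[b1 b2] := split_fine _ _ _ mK KB l2.
  by rewrite ler_norml; apply/andP; split; lra.
- have /andP[a1 a2] := split_fine _ _ _ mK KB l3.
  have /andP[b1 b2] := split_fine _ _ _ mK KB l4.
  by rewrite ler_norml; apply/andP; split; lra.
Qed.

End thin_null.

(** * Application to the outer and the inner boundary circle *)

Section annulus_boundary.
Variables (R : realType) (r0 : R).
Hypothesis hr0 : 0 < r0 < 1.
Implicit Types (p q : R * R) (mu : cmeasure R).

Let r0_gt0 : 0 < r0. Proof. by case/andP: hr0. Qed.
Let r0_lt1 : r0 < 1. Proof. by case/andP: hr0. Qed.

Lemma measurable_bdA : measurable (bdA r0).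
Proof. by apply: measurableU; exact: measurable_circle. Qed.

Lemma normc_circle (r : R) p : 0 <= r -> circle r p -> normc (toC p) = r.
Proof. by move=> r_ge0 pr; rewrite /normc/= pr sqrtr_sqr ger0_norm. Qed.

Lemma normc_bdA p : bdA r0 p -> r0 <= normc (toC p) <= 1.
Proof.
move=> [/(normc_circle ler01)|/(normc_circle (ltW r0_gt0))] ->.
- by rewrite lexx ltW.
- by rewrite lexx ltW.
Qed.

Lemma toC_neq0 p : bdA r0 p -> toC p != 0.
Proof. by move=> /normc_bdA /andP[h _]; rewrite -normc_gt0 (lt_le_trans r0_gt0). Qed.

Lemma cmeasurable_toC (S : set (R * R)) : cmeasurable S (@toC R).
Proof.
by split; apply: measurable_funTS; [exact: measurable_fst|exact: measurable_snd].
Qed.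

Lemma bmeasurable_toC : bmeasurable (bdA r0) (@toC R).
Proof.
split; first exact: cmeasurable_toC.
by exists 1 => p /normc_bdA/andP[].
Qed.

Lemma bmeasurable_toCV : bmeasurable (bdA r0) (fun p => (toC p)^-1).
Proof.
split; first by apply: cmeasurableV; exact: cmeasurable_toC.
exists r0^-1 => p bp; rewrite normcV lef_pV2 ?posrE ?normc_gt0 ?toC_neq0//.
by have /andP[] := normc_bdA bp.
Qed.

(** Negative powers are bounded because [|z| >= r0] on the boundary. *)
Lemma bmeasurable_toCXz (j : int) : bmeasurable (bdA r0) (fun p => toC p ^ j).
Proof.
case: j => n; first exact: (bmeasurableX n bmeasurable_toC).
under eq_fun do rewrite NegzE -exprnN -exprVn.
exact: (bmeasurableX n.+1 bmeasurable_toCV).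
Qed.

Lemma disjoint_circles : [disjoint (@circle R 1) & circle r0].
Proof.
apply/disj_setPS => p; rewrite /circle/= => -[-> h].
have : r0 ^+ 2 < 1 by rewrite expr_lt1// ltW.
by rewrite -h expr1n ltxx.
Qed.

Lemma cmint_bdA mu (f : R * R -> R[i]) : bmeasurable (bdA r0) f ->
  cmint mu (bdA r0) f = cmint mu (circle 1) f + cmint mu (circle r0) f.
Proof.
move=> [[mr mi] [B fB]].
have er (nu : {finite_measure set (R * R)%type -> \bar R}) :
    \int[nu]_(p in bdA r0) complex.Re (f p) =
    \int[nu]_(p in circle 1) complex.Re (f p) +
    \int[nu]_(p in circle r0) complex.Re (f p).
  apply: Rintegral_setU; [exact: measurable_circle|exact: measurable_circle| |
    exact: disjoint_circles].
  apply: (bounded_integrable nu measurable_bdA mr) => p Sp.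
  exact: le_trans (normc_Re _) (fB _ Sp).
have ei (nu : {finite_measure set (R * R)%type -> \bar R}) :
    \int[nu]_(p in bdA r0) complex.Im (f p) =
    \int[nu]_(p in circle 1) complex.Im (f p) +
    \int[nu]_(p in circle r0) complex.Im (f p).
  apply: Rintegral_setU; [exact: measurable_circle|exact: measurable_circle| |
    exact: disjoint_circles].
  apply: (bounded_integrable nu measurable_bdA mi) => p Sp.
  exact: le_trans (normc_Im _) (fB _ Sp).
rewrite /cmint !er !ei; apply/eqP; rewrite eq_complex/=.
by apply/andP; split; apply/eqP; ring.
Qed.

Variable mu : cmeasure R.
Hypothesis hcoef : forall j : int, mu_hat mu r0 j = - mu_hat mu 1 j.

(** The coefficient identity at index [- j] says that the contributions of the two circles
    cancel. *)
Lemma cmint_toCXz (j : int) : cmint mu (bdA r0) (fun p => toC p ^ j) = 0.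
Proof.
rewrite cmint_bdA; last exact: bmeasurable_toCXz.
by have := hcoef (- j); rewrite /mu_hat opprK => ->; rewrite subrr.
Qed.

Lemma cmval_thin_outer (B : set (R * R)) : measurable B -> B `<=` circle 1 ->
  thin 1 B -> cmval mu B = 0.
Proof.
apply: (@cmval_thin _ _ (bdA r0) 1 (@toC R)) => //.
- exact: measurable_bdA.
- by move=> p; left.
- exact: cmeasurable_toC.
- by move=> p /normc_bdA/andP[].
- by move=> j; have := cmint_toCXz j.
- by move=> p /(normc_circle ler01).
- by move=> p q _ _; rewrite divr1.
Qed.

(** Inversion exchanging the two circles: the inner one is sent to the unit circle, the outer one to
    radius [r0]. *)
Let zeta p : R[i] := r0%:C%C / toC p.

(** For [q] on the inner circle the right side is [cdist p q / |p|]: with [|p| <= 1] this gives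
    expansion, and with [|p| = r0] the Lipschitz bound. *)
Lemma normc_sub_inversion p q : toC p != 0 -> toC q != 0 ->
  normc (zeta p - zeta q) = r0 * cdist p q / (normc (toC p) * normc (toC q)).
Proof.
move=> p0 q0.
have -> : zeta p - zeta q = r0%:C%C * (toC q - toC p) / (toC p * toC q).
  by rewrite /zeta; field; rewrite p0 q0.
by rewrite normcM normcV !normcM normcR gtr0_norm// normcBC.
Qed.

Lemma cmval_thin_inner (B : set (R * R)) : measurable B -> B `<=` circle r0 ->
  thin r0 B -> cmval mu B = 0.
Proof.
have circ_bd p : circle r0 p -> bdA r0 p by right.
apply: (@cmval_thin _ _ (bdA r0) r0 zeta) => //.
- exact: measurable_bdA.
- apply: cmeasurableM; first exact: cmeasurable_cst.
  by apply: cmeasurableV; exact: cmeasurable_toC.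
- move=> p bp; have /andP[h _] := normc_bdA bp.
  rewrite normcM normcV normcR gtr0_norm// ler_pdivrMr ?mul1r//.
  exact: lt_le_trans h.
- move=> j.
  (* Nonnegative powers of [zeta] are multiples of nonpositive powers of [z], so here the other half
     of the moments enters. *)
  have -> : (fun p => zeta p ^+ j) = (fun p => r0%:C%C ^+ j * toC p ^ (- j%:Z)).
    by apply/funext => p; rewrite /zeta exprMn exprVn -exprnN.
  rewrite cmintZ; [|exact: measurable_bdA|exact: bmeasurable_toCXz].
  by rewrite cmint_toCXz mulr0.
- move=> p cp; rewrite normcM normcV normcR gtr0_norm// (normc_circle (ltW r0_gt0) cp).
  by rewrite divff// gt_eqF.
- move=> p q bp cq; have bq := circ_bd _ cq.
  rewrite normc_sub_inversion ?toC_neq0// (normc_circle (ltW r0_gt0) cq).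
  have /andP[h1 h2] := normc_bdA bp.
  have n0 := lt_le_trans r0_gt0 h1.
  rewrite ler_pdivlMr ?mulr_gt0// [leRHS]mulrC mulrA ler_pM2r//.
  by rewrite ler_piMr// normc_ge0.
- move=> p q cp cq; have bp := circ_bd _ cp; have bq := circ_bd _ cq.
  rewrite normc_sub_inversion ?toC_neq0// !(normc_circle (ltW r0_gt0))//.
  by rewrite -mulf_div divff ?mul1r// gt_eqF.
Qed.

End annulus_boundary.

(** * Total variation and the conclusion for the whole boundary *)

Lemma cm_totvar_eq0 (R : realType) (mu : cmeasure R) (F : set (R * R)) :
  measurable F -> (forall B, measurable B -> B `<=` F -> cmval mu B = 0) ->
  cm_totvar mu F = 0%E.
Proof.
move=> mF h; rewrite /cm_totvar; set X := [set _ | _ in _].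
suff -> : X = [set 0%E] by rewrite ereal_sup1.
have X0 (G : (set (R * R))^nat) : (forall n, measurable (G n)) -> \bigcup_n G n = F ->
    (\sum_(0 <= n <oo) (normc (cmval mu (G n)))%:E = 0)%E.
  move=> mG GF; apply: eseries0 => n _ _; rewrite h ?normc0//.
  by rewrite -GF; exact: bigcup_sup.
apply/seteqP; split => [_ [G [mG tG GF] <-]|_ ->]; first exact: X0.
(* At least one partition must be exhibited, because the supremum of the empty set is [-oo]; here it
   is [F] followed by empty sets. *)
pose G (n : nat) := if n is 0%N then F else set0.
have mG n : measurable (G n) by case: n => [|n]; [exact: mF|exact: measurable0].
have GF : \bigcup_n G n = F.
  by apply/seteqP; split => [p [[|n] _]//|p Fp]; exists 0%N.
exists G; last exact: X0.
by split => //; move=> [|i] [|j] _ _ //= [p []].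
Qed.

Lemma cmvalU (R : realType) (mu : cmeasure R) (A B : set (R * R)) :
  measurable A -> measurable B -> A `&` B = set0 ->
  cmval mu (A `|` B) = cmval mu A + cmval mu B.
Proof.
move=> mA mB AB.
have fU (nu : {finite_measure set (R * R)%type -> \bar R}) :
    fine (nu (A `|` B)) = fine (nu A) + fine (nu B).
  by rewrite measureU// fineD//; exact: fin_num_measure.
rewrite /cmval !fU; apply/eqP; rewrite eq_complex/=.
by apply/andP; split; apply/eqP; ring.
Qed.

Theorem theorem1p2 (R : realType) (r0 : R) (hr0 : 0 < r0 < 1)
  (mu : cmeasure R) (hmu : cm_on mu (bdA r0))
  (hcoef : forall j : int, mu_hat mu r0 j = - mu_hat mu 1 j)
  (E : set (R * R)) (hE : E `<=` bdA r0)
  (h1 : arclength_null 1 (E `&` circle 1))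
  (h0 : arclength_null r0 (E `&` circle r0)) :
  cm_null mu E.
Proof.
have r0_gt0 : 0 < r0 by case/andP: hr0.
have [F1 [mF1 EF1 F1c t1]] :=
  thin_measurable_cover (@subIsetr _ _ _) (arclength_null_thin ltr01 h1).
have [F0 [mF0 EF0 F0c t0]] :=
  thin_measurable_cover (@subIsetr _ _ _) (arclength_null_thin r0_gt0 h0).
exists (F1 `|` F0); split.
- exact: measurableU.
- by move=> p Ep; case: (hE p Ep) => cp; [left; apply: EF1|right; apply: EF0].
apply: cm_totvar_eq0 => [|B mB BF]; first exact: measurableU.
(* The first piece lies on the unit circle; the second lies in [F0], hence on the inner circle. *)
have -> : B = (B `&` F1) `|` (B `\` F1) by rewrite setUIDK.
rewrite cmvalU.
- rewrite (cmval_thin_outer hr0 hcoef (B := B `&` F1)).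
  + rewrite (cmval_thin_inner hr0 hcoef (B := B `\` F1)) ?addr0//.
    * exact: measurableD.
    * by move=> p [/BF[]// /F0c].
    * by apply: thin_sub t0 => p [/BF[]].
  + exact: measurableI.
  + by move=> p [_ /F1c].
  + by apply: thin_sub t1 => p [].
- exact: measurableI.
- exact: measurableD.
- by apply/seteqP; split => // p [[_ ?] [_ ]].
Qed.
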